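(* Let $G$ be a Lie group, $\Gamma\subset G$ a discrete subgroup, $F=\{g_t:t\in\mathbb{R}\}$ a one-parameter subgroup of $G$, and $H^+=\{g\in G:g_{-t}gg_t\to e\text{ as }t\to+\infty\}$. Let $H$ be a nontrivial connected subgroup of $H^+$ normalized by $F$, and let $\mathcal{F}=\{\Phi_t:t>0\}$, $\Phi_t(h)=g_{-t}hg_t$, restricted to $H$. Fix an admissible initial domain $D_0\subset H$ for the modified Schmidt game (MSG) induced by $\mathcal{F}$ on $H$. Then there exists $a''>0$ such that for any $a>a''$ and any $x,z\in G/\Gamma$, the set $$\{h\in H: hx\in E(F^+,z)\}$$ is an $a$-winning set for the MSG induced by $\mathcal{F}$.
   Context: $F^+=\{g_t:t\ge 0\}$ acts on $G/\Gamma$ by left translations; for $z\in G/\Gamma$, $E(F^+,z)=\{y\in G/\Gamma: z\notin\overline{F^+y}\}$. Modified Schmidt games. Let $H$ be a connected Lie group and $\{\Phi_t:t\in\mathbb{R}\}$ a one-parameter group of automorphisms of $H$ such that $\Phi_t$ is contracting for $t>0$ (that is, $\Phi_t^k(h)\to e$ as $k\to\infty$ for every $h\in H$); put $\mathcal{F}=\{\Phi_t:t>0\}$. A set $D_0\subset H$ is admissible if it is compact with non-empty interior. Given an admissible $D_0$, let $\mathcal{D}_t=\{\Phi_t(D_0)h:h\in H\}$ for $t\in\mathbb{R}$, and fix $a_*$ such that for every $t>a_*$ some element of $\mathcal{D}_t$ is contained in $D_0$ (such $a_*$ exists). For $a,b>a_*$ the game is: Bob picks $t_1\in\mathbb{R}$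 and $B_1\in\mathcal{D}_{t_1}$; with $t_k=t_1+(k-1)(a+b)$ and $t_k'=t_k+a$, at step $k\geq 1$ Alice picks $A_k\in\mathcal{D}_{t_k'}$ with $A_k\subset B_k$, and then Bob picks $B_{k+1}\in\mathcal{D}_{t_{k+1}}$ with $B_{k+1}\subset A_k$. The intersection $\bigcap_k A_k=\bigcap_k B_k$ is a single point. A set $S\subset H$ is $(a,b)$-winning if Alice can play so that this point lies in $S$ no matter how Bob plays; $S$ is $a$-winning (where $a>a_*$) if it is $(a,b)$-winning for every $b>a_*$; $S$ is winning if it is $a$-winning for some $a>a_*$. The MSG induced by $\mathcal{F}$ is this game for some fixed admissible $D_0$; the game and the value of $a_*$ depend on $D_0$, but the class of winning sets does not. *)

(* Defs.v *)
From HB Require Import structures.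
From mathcomp Require Import all_boot all_order all_algebra.
From mathcomp Require Import all_classical all_reals all_analysis.

Set Implicit Arguments.
Unset Strict Implicit.
Unset Printing Implicit Defensive.

Import Order.TTheory GRing.Theory Num.Theory.
Import numFieldNormedType.Exports.

Local Open Scope classical_set_scope.
Local Open Scope ring_scope.

(* C^k and C^oo functions on an open set [U]; the values of [f] off [U] are
   irrelevant. *)
Fixpoint Ck_on (R : realType) (V W : normedModType R) (U : set V) (k : nat)
    (f : V -> W) : Prop :=
  match k with
  | 0%N => forall x, U x -> {for x, continuous f}
  | k'.+1 => (forall x, U x -> differentiable f x) /\
             (forall v, Ck_on U k' (fun x => 'D_v f x))
  end.

Definition smooth_on (R : realType) (V W : normedModType R) (U : set V)
    (f : V -> W) : Prop :=
  forall k, Ck_on U k f.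

(* [chart_map] is only meaningful on [chart_dom], and [chart_inv], the inverse
   of [chart_map], only on [chart_map @` chart_dom]. *)
Record chart (R : realType) (n : nat) (T : Type) := Chart {
  chart_dom : set T;
  chart_map : T -> 'rV[R]_n;
  chart_inv : 'rV[R]_n -> T }.

Definition is_chart (R : realType) (n : nat) (T : topologicalType)
    (c : chart R n T) : Prop :=
  [/\ open (chart_dom c), open (chart_map c @` chart_dom c),
      {within chart_dom c, continuous (chart_map c)},
      {within chart_map c @` chart_dom c, continuous (chart_inv c)} &
      forall x, chart_dom c x -> chart_inv c (chart_map c x) = x].

Definition is_smooth_atlas (R : realType) (n : nat) (T : topologicalType)
    (A : set (chart R n T)) : Prop :=
  [/\ forall c, A c -> is_chart c,
      forall x, exists2 c, A c & chart_dom c x &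
      forall c c', A c -> A c' ->
        smooth_on (chart_map c @` (chart_dom c `&` chart_dom c'))
          (chart_map c' \o chart_inv c)].

HB.mixin Record isTopologicalGroup G of Group G & Topological G := {
  mulg_continuous : continuous (fun p : G * G => (p.1 * p.2)%g);
  invg_continuous : continuous (fun x : G => (x^-1)%g) }.

#[short(type="topGroupType")]
HB.structure Definition TopologicalGroup :=
  {G of isTopologicalGroup G & Group G & Topological G}.

(* Hausdorff, but not required to have countably many components. *)
HB.mixin Record isLieGroup (R : realType) (n : nat) G
    of TopologicalGroup G := {
  lie_hausdorff : hausdorff_space G;
  lie_atlas : set (chart R n G);
  lie_atlasP : is_smooth_atlas lie_atlas;
  mulg_smooth : forall c1 c2 c3 : chart R n G,
    lie_atlas c1 -> lie_atlas c2 -> lie_atlas c3 ->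
    smooth_on
      [set p : 'rV[R]_n * 'rV[R]_n |
        [/\ (chart_map c1 @` chart_dom c1) p.1,
            (chart_map c2 @` chart_dom c2) p.2 &
            chart_dom c3 (chart_inv c1 p.1 * chart_inv c2 p.2)%g]]
      (fun p => chart_map c3 (chart_inv c1 p.1 * chart_inv c2 p.2)%g);
  invg_smooth : forall c1 c2 : chart R n G,
    lie_atlas c1 -> lie_atlas c2 ->
    smooth_on
      [set u | (chart_map c1 @` chart_dom c1) u /\
               chart_dom c2 ((chart_inv c1 u)^-1)%g]
      (fun u => chart_map c2 ((chart_inv c1 u)^-1)%g) }.

#[short(type="lieGroupType")]
HB.structure Definition LieGroup (R : realType) (n : nat) :=
  {G of isLieGroup R n G & TopologicalGroup G}.

Section Cosets.
Context {G : topGroupType} (Gamma : groupClosed G).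

Definition coset_rel : rel G := fun x y => (x^-1 * y)%g \in Gamma.

Lemma coset_rel_equiv : equiv_class_of coset_rel.
Proof.
split=> [x | x y | y x z].
- by rewrite /coset_rel mulVg gpred1.
- by rewrite /coset_rel -gpredV invgM invgK.
- rewrite /coset_rel => xy yz.
  by have := gpredM _ _ xy yz; rewrite mulgA mulgK.
Qed.

Canonical coset_equiv : equiv_rel G := EquivRelPack coset_rel_equiv.

(* G/Gamma, the space of left cosets x Gamma, with the quotient topology. *)
Definition coset_space := quotient_topology {eq_quot coset_equiv}%qT.
HB.instance Definition _ := Topological.on coset_space.
HB.instance Definition _ := Quotient.on coset_space.

(* [repr] picks a representative of a coset; the result does not depend on
   it. *)
Definition translate (y : G) (x : coset_space) : coset_space :=
  \pi_coset_space%qT (y * repr x)%g.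

Lemma translate_pi (y x : G) :
  translate y (\pi_coset_space%qT x) = \pi_coset_space%qT (y * x)%g.
Proof.
apply/(@eqmodP _ coset_equiv); rewrite /= /coset_rel invgM mulgA mulgVK.
exact/(@eqmodP _ coset_equiv)/(reprK (\pi_coset_space%qT x)).
Qed.

End Cosets.

Definition one_parameter_subgroup (R : realType) (G : topGroupType)
    (g : R -> G) : Prop :=
  continuous g /\ forall s t, g (s + t) = (g s * g t)%g.

Definition conj_flow (R : realType) (G : topGroupType) (g : R -> G)
    (t : R) (h : G) : G :=
  (g (- t) * h * g t)%g.

Definition horospherical (R : realType) (G : topGroupType) (g : R -> G) :
    set G :=
  [set h | conj_flow g t h @[t --> +oo] --> (1%g : G)].

Definition normalized_by (R : realType) (G : topGroupType) (H : groupClosed G)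
    (g : R -> G) : Prop :=
  forall t h, h \in H -> (g t * h * (g t)^-1)%g \in H.

(* E(F^+, z), with F^+ = {g_t : t >= 0}. *)
Definition escaping (R : realType) (G : topGroupType) (Gamma : groupClosed G)
    (g : R -> G) (z : coset_space Gamma) : set (coset_space Gamma) :=
  [set y | ~ closure [set translate (g t) y | t in [set t | 0 <= t]] z].

(* The modified Schmidt game on a subgroup [H] of [G], for maps [Phi t]
   preserving [H]; [H] carries the topology induced by [G]. *)
Section ModifiedSchmidtGame.
Context {R : realType} {G : topGroupType}.
Variables (H : groupClosed G) (Phi : R -> G -> G) (D0 : set G).

Definition admissible : Prop :=
  [/\ D0 `<=` [set` H], compact D0 &
      exists U, [/\ open U, U `&` [set` H] !=set0 & U `&` [set` H] `<=` D0]].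

Definition msg_domain (t : R) : set (set G) :=
  [set [set (Phi t d * h)%g | d in D0] | h in [set` H]].

Definition msg_threshold (astar : R) : Prop :=
  forall t, astar < t -> exists2 D, msg_domain t D & D `<=` D0.

(* Steps are numbered from 0: [B k] is Bob's choice of radius parameter
   t1 + k(a+b), and [A k] is Alice's answer to it. *)
Definition bob_move (a b t1 : R) (B A : nat -> set G) (k : nat) : Prop :=
  msg_domain (t1 + (a + b) *+ k) (B k) /\
  (if k is j.+1 then B k `<=` A j else True).

Definition alice_move (a b t1 : R) (B A : nat -> set G) (k : nat) : Prop :=
  msg_domain (t1 + (a + b) *+ k + a) (A k) /\ A k `<=` B k.

(* From [t1] and Bob's choices so far, a strategy computes Alice's answer. *)
Definition strategy := R -> seq (set G) -> set G.

Definition answers (sigma : strategy) (t1 : R) (B : nat -> set G) (k : nat) :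
    set G :=
  sigma t1 (mkseq B k.+1).

(* The first condition makes [sigma] answer legally as long as Bob has played
   legally; otherwise an illegal answer could win by leaving Bob no move. *)
Definition winning_strategy (a b : R) (S : set G) (sigma : strategy) : Prop :=
  forall (t1 : R) (B : nat -> set G), let A := answers sigma t1 B in
    (forall k, (forall j, (j <= k)%N -> bob_move a b t1 B A j) ->
       alice_move a b t1 B A k) /\
    ((forall k, bob_move a b t1 B A k) ->
       exists2 p, \bigcap_k A k = [set p] & S p).

Definition ab_winning (a b : R) (S : set G) : Prop :=
  exists sigma, winning_strategy a b S sigma.

Definition a_winning (astar a : R) (S : set G) : Prop :=
  astar < a /\ forall b, astar < b -> ab_winning a b S.

End ModifiedSchmidtGame.

(* Main.v *)
Require Import Defs.
From HB Require Import structures.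
From mathcomp Require Import all_boot all_order all_algebra.
From mathcomp Require Import all_classical all_reals all_analysis.
From mathcomp Require Import lra.

(** Why the set is winning.

    Write [Phi t h = g (- t) * h * g t]. When Bob's set is [Phi t D0 * h], the
    map [g t] sends its orbit through a point [x] to [D0 * y] with
    [y = g t * h * x], a piece of an orbit of [H] of a fixed size. At an earlier
    time [t - s] the same piece has been shrunk to [Phi s D0 * (g (- s) * y)].
    Alice lets her answer at stage [k] take care of a window of times
    [t_k - c - T <= t <= t_k - c] long past, where [T = a + b] is the distance
    between two stages; these windows cover all nonnegative times. Long
    past means that during the whole window the image of Bob's set is tiny, so
    that it can meet a neighbourhood of [z] in essentially one point. Indeed, if
    [d * y] and [d' * y] pass through [z] at the times [- s] and [- s'], then
    [Phi s (d * d'^-1) * g (s' - s)] is an element of the discrete group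
    [z Gamma z^-1]; as its first factor is nearly [1], it lies within a small
    distance of the compact curve [g `[- T, T]], hence on the curve, and then
    [Phi s (d * d'^-1)] is an element of [H] that the flow both fixes and
    contracts, so [d = d'] ([late_returns_coincide]). By compactness, returns to a
    small neighbourhood of [z] only come from points [d] that are close to each
    other, uniformly in [y] ([late_near_returns_close]).

    Hence Alice only has to be able to stay away from one small spot of [D0]. For
    [a] large, [D0] contains two translates of [Phi a D0] that are separated by a
    distance independent of [a] ([two_separated_copies]), and one of them misses
    the spot ([dodging_move]). The threshold on [a] depends neither on [b] nor on
    [x] and [z]: only the delay [c] and the neighbourhood of [z] do.

    The quantitative input is that [Phi t] contracts the compact set [D0]
    uniformly. The hypothesis gives pointwise contraction; a Baire category
    argument inside [D0] upgrades it to equicontinuity at [1]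
    ([conj_flow_equicontinuous]), and compactness then yields uniformity
    ([conj_flow_uniform]). *)

Set Implicit Arguments.
Unset Strict Implicit.
Unset Printing Implicit Defensive.

Import Order.TTheory GRing.Theory Num.Theory.
Import numFieldNormedType.Exports.

Local Open Scope classical_set_scope.
Local Open Scope ring_scope.

(** * Compact sets *)

Lemma nested_compact_nonempty (T : topologicalType) (K : nat -> set T) :
  compact (K 0%N) -> (forall k, closed (K k)) ->
  (forall k, K k.+1 `<=` K k) -> (forall k, K k !=set0) ->
  \bigcap_k K k !=set0.
Proof.
move=> cptK clK decK K0.
have monoK i j : (i <= j)%N -> K j `<=` K i.
  move=> /subnKC <-; elim: (j - i)%N => [|m IH]; first by rewrite addn0.
  by rewrite addnS; apply: subset_trans (decK _) IH.
pose F := filter_from setT K.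
have FF : ProperFilter F.
  apply: filter_from_proper; last by move=> i _; exact: K0.
  apply: filter_from_filter; first by exists 0%N.
  move=> i j _ _; exists (maxn i j) => // x Kx.
  by split; apply: monoK Kx; rewrite (leq_maxl, leq_maxr).
have [|p [_ clp]] := cptK F FF; first by exists 0%N.
exists p => k _; apply: clK => B nB.
by apply: clp nB; exists k.
Qed.

(** The Baire property of a compact subset [D] of a regular space: otherwise one
    could shrink [O] successively away from each [E n], keeping closures inside
    the preceding open set, and compactness would leave a point of [D] outside
    every [E n]. *)
Lemma compact_baire (T : topologicalType) (D O : set T) (E : nat -> set T) :
  regular_space T -> compact D -> closed D ->
  open O -> O `&` D !=set0 -> (forall n, closed (E n)) ->
  O `&` D `<=` \bigcup_n E n ->
  exists n O', [/\ open O', O' `<=` O, O' `&` D !=set0 & O' `&` D `<=` E n].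
Proof.
move=> regT cptD clD oO OD clE cover; apply: contrapT => noE.
pose P (U : set T) := [/\ open U, U `<=` O & U `&` D !=set0].
have step n U : P U -> exists V, P V /\ closure V `<=` U `\` E n.
  move=> [oU UO UD].
  have [x [[Ux Dx] nEx]] : exists x, (U `&` D) x /\ ~ E n x.
    apply: contrapT => nx; apply: noE; exists n, U; split=> // x UDx.
    by apply: contrapT => nEx; apply: nx; exists x.
  have nxU : nbhs x (U `\` E n).
    apply: open_nbhs_nbhs; split => //.
    by rewrite setDE; apply: openI => //; exact: closed_openC.
  have [B nB clB] := regT x _ nxU.
  have [V [oV Vx] VB] : exists2 V, open V /\ V x & V `<=` B.
    by move: nB; rewrite nbhsE => -[V [oV Vx] VB]; exists V.
  have clV : closure V `<=` U `\` E n.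
    by apply: subset_trans clB; exact: closureS.
  exists V; split => //; split => //; last by exists x.
  move=> y Vy; apply: UO.
  by have [] := clV _ (@subset_closure _ _ _ Vy).
pose next n (U : {U | P U}) : {U | P U} :=
  let: exist V PV := cid (step n (sval U) (svalP U)) in exist P V PV.1.
have nextP n U : closure (sval (next n U)) `<=` sval U `\` E n.
  by rewrite /next; case: cid => V [PV clV].
have PO : P O by split.
pose Us := fix F n := if n is m.+1 then next m (F m) else exist P O PO.
pose K n := closure (sval (Us n.+1)) `&` D.
have [||||p Kp] := @nested_compact_nonempty T K.
- by rewrite /K setIC; apply: compact_closedI => //; exact: closed_closure.
- by move=> k; apply: closedI => //; exact: closed_closure.
- move=> k; apply: setSI => x /nextP [+ _]; exact: subset_closure.
- move=> k; have [_ _ [x [Ux Dx]]] := svalP (Us k.+1).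
  by exists x; split => //; exact: subset_closure.
have [Op nE0] : (O `\` E 0%N) p.
  by have [/nextP] := Kp 0%N I.
have [|n _ Enp] := cover p; first by split=> //; have [] := Kp 0%N I.
by have [/nextP[]] := Kp n I.
Qed.

(** * Topological groups *)

Section TopologicalGroups.
Context {G : topGroupType}.
Local Open Scope group_scope.

Lemma cvgMg I (F : set_system I) {FF : Filter F} (f h : I -> G) a b :
  f @ F --> a -> h @ F --> b -> (fun i => f i * h i) @ F --> a * b.
Proof.
move=> fa hb.
exact: (cvg_comp2 fa hb (mulg_continuous (a, b))).
Qed.

Lemma cvgVg I (F : set_system I) {FF : Filter F} (f : I -> G) a :
  f @ F --> a -> (fun i => (f i)^-1) @ F --> a^-1.
Proof. by move=> fa; apply: (continuous_cvg _ (@invg_continuous G a)). Qed.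

Lemma nbhs_mulg (V : set G) : nbhs (1 : G) V ->
  exists2 M, nbhs (1 : G) M & forall x y, M x -> M y -> V (x * y).
Proof.
move=> nV; have := mulg_continuous (1 : G, 1 : G).
rewrite /continuous_at /= mulg1 => /(_ _ nV) [[A B] /= [nA nB] AB].
exists (A `&` B); first exact: filterI.
by move=> x y [Ax _] [_ By]; exact: (AB (x, y)).
Qed.

Lemma nbhs_divg (c : G) (V : set G) : nbhs (1 : G) V ->
  exists2 M, nbhs c M & forall x y, M x -> M y -> V (x * y^-1).
Proof.
move=> nV.
have : (fun p : G * G => p.1 * p.2^-1) @ (c, c) --> c * c^-1.
  by apply: cvgMg; [exact: cvg_fst | apply: cvgVg; exact: cvg_snd].
rewrite mulgV => /(_ _ nV) [[A B] /= [nA nB] AB].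
exists (A `&` B); first exact: filterI.
by move=> x y [Ax _] [_ By]; exact: (AB (x, y)).
Qed.

Lemma cvg_mulr (x c : G) : (fun y => y * c) @ x --> x * c.
Proof. by apply: cvgMg; [exact: cvg_id | exact: cvg_cst]. Qed.

Lemma topgroup_regular : regular_space G.
Proof.
move=> x N nN.
have [M nM MN] : exists2 M, nbhs (1 : G) M & forall m m', M m -> M m' ->
    N (m^-1 * m' * x).
  have : (fun p : G * G => p.1^-1 * p.2 * x) @ (1 : G, 1 : G) --> 1^-1 * 1 * x.
    apply: cvgMg; last exact: cvg_cst.
    by apply: cvgMg; [apply: cvgVg; exact: cvg_fst | exact: cvg_snd].
  rewrite invg1 !mul1g => /(_ _ nN) [[A B] /= [nA nB] AB].
  exists (A `&` B); first exact: filterI.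
  by move=> m m' [Am _] [_ Bm']; exact: (AB (m, m')).
have translate_nbhs y : nbhs y [set m * y | m in M].
  have := @cvg_mulr y y^-1; rewrite mulgV => zy1.
  near=> z; exists (z * y^-1); last by rewrite mulgVK.
  by near: z; exact: zy1.
exists [set m * x | m in M] => // y cly.
have [_ [[m Mm <-] [m' Mm' e]]] := cly _ (translate_nbhs y).
have -> : y = m'^-1 * m * x by rewrite -mulgA -e mulKg.
exact: MN.
Unshelve. all: by end_near. Qed.

Lemma near_neq (T : topologicalType) I (F : set_system I) {FF : Filter F}
    (f h : I -> T) (a b : T) : hausdorff_space T ->
  f @ F --> a -> h @ F --> b -> a <> b -> \forall i \near F, f i <> h i.
Proof.
rewrite open_hausdorff => hT fa hb /eqP/hT[[A B]] /=.
rewrite !inE => -[Aa Bb] [oA oB /eqP AB].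
have nA : nbhs a A by exact: open_nbhs_nbhs.
have nB : nbhs b B by exact: open_nbhs_nbhs.
near=> i => e.
have : (A `&` B) (f i).
  split; first by near: i; exact: fa.
  by rewrite e; near: i; exact: hb.
by rewrite (eqP AB).
Unshelve. all: by end_near. Qed.

(** Discreteness at the identity makes the subgroup closed and locally finite:
    two elements of the subgroup close to [c] have quotient close to [1]. *)
Lemma discrete_subgroup_near (D : groupClosed G) (c : G) :
  hausdorff_space G -> isolated [set` D] = [set` D] ->
  \forall x \near c, x \in D -> x = c.
Proof.
move=> hG isoD.
have [_ [V nV VD]] : isolated [set` D] (1 : G).
  by rewrite isoD /= gpred1.
have [A nA AV] := nbhs_divg c nV.
have [[s [As Ds sc]]|none] :=
  pselect (exists s, [/\ A s, s \in D & s <> c]).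
  have near_s : \forall x \near c, x <> s.
    by apply: near_neq hG cvg_id (cvg_cst s) _; exact: nesym.
  near=> x => Dx; exfalso.
  have Ax : A x by near: x.
  have : (V `&` [set` D]) (x * s^-1).
    by split; [exact: AV | rewrite /= gpredM ?gpredV].
  rewrite VD => /divg1_eq; exact: (near near_s x).
near=> x => Dx; apply: contrapT => xc; apply: none; exists x; split => //.
by near: x.
Unshelve. all: by end_near. Qed.

End TopologicalGroups.

(** * The conjugation flow *)

Section ConjugationFlow.
Context {R : realType} {G : topGroupType} (g : R -> G).
Hypothesis g_one_param : one_parameter_subgroup g.
Local Open Scope group_scope.
Local Notation Phi := (conj_flow g).

Lemma one_param0 : g 0%R = 1.
Proof.
by apply: (@mulgI _ (g 0%R)); rewrite mulg1 -(g_one_param.2) addr0.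
Qed.

Lemma one_paramN t : g (- t)%R = (g t)^-1.
Proof.
by apply: (@mulgI _ (g t)); rewrite mulgV -(g_one_param.2) subrr one_param0.
Qed.

Lemma conj_flow0 h : Phi 0%R h = h.
Proof. by rewrite /conj_flow oppr0 one_param0 mul1g mulg1. Qed.

Lemma conj_flowD s t h : Phi (s + t)%R h = Phi s (Phi t h).
Proof.
by rewrite /conj_flow [in g (s + t)%R]addrC opprD !(g_one_param.2) !mulgA.
Qed.

Lemma conj_flowM t h h' : Phi t (h * h') = Phi t h * Phi t h'.
Proof. by rewrite /conj_flow one_paramN !mulgA mulgK. Qed.

Lemma conj_flow1 t : Phi t 1 = 1.
Proof. by rewrite /conj_flow mulg1 one_paramN mulVg. Qed.

Lemma conj_flowV t h : Phi t h^-1 = (Phi t h)^-1.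
Proof.
by apply: (@mulgI _ (Phi t h)); rewrite -conj_flowM !mulgV conj_flow1.
Qed.

Lemma conj_flow_div t h h' : Phi t (h * h'^-1) = Phi t h * (Phi t h')^-1.
Proof. by rewrite conj_flowM conj_flowV. Qed.

Lemma conj_flow_one_param t s : Phi t (g s) = g s.
Proof.
by rewrite /conj_flow -!(g_one_param.2); congr g; rewrite addrAC addNr add0r.
Qed.

Lemma conj_flow_inj t : injective (Phi t).
Proof.
by apply: (can_inj (g := Phi (- t)%R)) => h; rewrite -conj_flowD addNr conj_flow0.
Qed.

Lemma cvg_one_param I (F : set_system I) {FF : Filter F} (s : I -> R) t :
  s @ F --> t -> (fun i => g (s i)) @ F --> g t.
Proof. by apply: continuous_cvg; exact: (g_one_param.1). Qed.

Lemma cvg_conj_flow I (F : set_system I) {FF : Filter F} (s : I -> R) t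
    (x : I -> G) h :
  s @ F --> t -> x @ F --> h -> (fun i => Phi (s i) (x i)) @ F --> Phi t h.
Proof.
move=> st xh; rewrite /conj_flow; apply: cvgMg; last exact: cvg_one_param.
apply: cvgMg xh; apply: cvg_one_param; exact: cvgN.
Qed.

(** * Contraction on a normalized horospherical subgroup *)

Variables (H : groupClosed G) (D0 : set G).
Hypotheses (hG : hausdorff_space G)
  (H_horospherical : [set` H] `<=` horospherical g)
  (H_normalized : normalized_by H g)
  (D0_admissible : admissible H D0).

Lemma conj_flow_in t h : h \in H -> Phi t h \in H.
Proof.
by move=> /(H_normalized (- t)); rewrite /conj_flow !one_paramN invgK.
Qed.

(** An element of the one-parameter subgroup is fixed by the flow, an element of
    [H] is contracted by it. *)
Lemma one_param_horospherical s : g s \in H -> g s = 1.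
Proof.
move=> /H_horospherical; rewrite /horospherical /=.
under eq_fun do rewrite conj_flow_one_param.
by move=> gs1; exact: (cvg_unique hG (cvg_cst (F := +oo%R) (g s)) gs1).
Qed.

Lemma admissible_sub : D0 `<=` [set` H].
Proof. by case: D0_admissible. Qed.

Lemma admissible_compact : compact D0.
Proof. by case: D0_admissible. Qed.

Lemma admissible_nonempty : D0 !=set0.
Proof. by case: D0_admissible => _ _ [U [_ [x Ux] UD]]; exists x; exact: UD. Qed.

(** Pointwise contraction says that [D0] is covered by the closed sets on which
    the flow stays in a small neighbourhood from time [N] on. By the Baire
    property one of them has interior, and translating by a point of that
    interior moves the control to the identity. *)
Lemma conj_flow_equicontinuous (V : set G) : nbhs (1 : G) V ->
  exists N : R, \forall h \near (1 : G), h \in H ->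
    forall t, (N <= t)%R -> V (Phi t h).
Proof.
move=> nV.
have [A nA AV] := nbhs_divg 1 nV.
have [M nM MA] := topgroup_regular nA.
have [_ _ [U [oU [x0 Ux0] UD]]] := D0_admissible.
have UDH x : (U `&` D0) x -> x \in H by case=> _ /admissible_sub.
pose E (N : nat) := [set h | forall t, (N%:R <= t)%R -> closure M (Phi t h)].
have clE N : closed (E N).
  rewrite (_ : E N = \bigcap_(t in [set t | N%:R <= t]%R)
                       (Phi t @^-1` closure M)); last first.
    by apply/seteqP; split=> h; [move=> Eh t /Eh | move=> Eh t Nt; exact: Eh].
  apply: closed_bigI => t _; apply: closed_comp; last exact: closed_closure.
  move=> h _.
  exact: (cvg_conj_flow (F := nbhs h) (cvg_cst t) cvg_id).
have UD0 : U `&` D0 !=set0.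
  by exists x0; split; [case: Ux0 | exact: UD].
have cover : U `&` D0 `<=` \bigcup_N E N.
  move=> h /UDH /H_horospherical /(_ _ nM) [T [_ TM]].
  exists (Num.bound `|T|%R) => // t Nt; apply: subset_closure; apply: TM.
  by apply: lt_le_trans Nt; rewrite (le_lt_trans (ler_norm T)) // archi_boundP.
have [N [W [oW WU [h0 [Wh0 Dh0]] WE]]] :=
  compact_baire topgroup_regular admissible_compact
    (compact_closed hG admissible_compact) oU UD0 clE cover.
have Hh0 := admissible_sub Dh0.
exists N%:R%R.
have nW : \forall h \near (1 : G), W (h * h0).
  have := @cvg_mulr _ 1 h0; rewrite mul1g.
  by apply; exact: open_nbhs_nbhs.
near=> h => Hh t Nt.
have Whh0 : W (h * h0) by near: h.
have -> : Phi t h = Phi t (h * h0) * (Phi t h0)^-1 by rewrite conj_flowM mulgK.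
apply: AV.
- apply: MA; apply: WE Nt; split => //; apply: UD; split; first exact: WU.
  by rewrite /= gpredM.
- by apply: MA; apply: WE Nt.
Unshelve. all: by end_near. Qed.

(** Near a point [d], [Phi t d'] is the product of [Phi t (d' * d^-1)], small by
    equicontinuity, and [Phi t d], small for [t] large; [D0] being compact,
    finitely many such [d] suffice. *)
Lemma conj_flow_uniform (V : set G) : nbhs (1 : G) V ->
  \forall t \near +oo%R, forall d, D0 d -> V (Phi t d).
Proof.
move=> nV.
have [A nA AV] := nbhs_mulg nV.
have [N equi] := conj_flow_equicontinuous nA.
have := (compact_near_coveringP D0).1 admissible_compact R +oo%R
  (fun t d => d \in H -> V (Phi t d)) _.
move=> cover; have {}cover : \forall t \near +oo%R,
    forall d, D0 d -> d \in H -> V (Phi t d).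
  apply: cover => d Dd.
  have Hd := admissible_sub Dd.
  have near_d : \forall d' \near d, d' * d^-1 \in H ->
      forall t, (N <= t)%R -> A (Phi t (d' * d^-1)).
    by have := @cvg_mulr _ d d^-1; rewrite mulgV => /(_ _ equi).
  near=> d' t => /= Hd'.
  have -> : d' = (d' * d^-1) * d by rewrite mulgVK.
  rewrite conj_flowM; apply: AV.
    have Nt : (N <= t)%R by near: t; apply: nbhs_pinfty_ge; exact: num_real.
    have near_t : d' * d^-1 \in H -> forall t, (N <= t)%R -> A (Phi t (d' * d^-1)).
      by near: d'.
    by apply: near_t Nt; rewrite gpredM ?gpredV.
  by near: t; exact: (H_horospherical Hd).
by apply: filterS cover => t VD d Dd; apply: VD => //; exact: admissible_sub.
Unshelve. all: by end_near. Qed.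

End ConjugationFlow.

(** * Separated copies of the domain and late returns *)

Section Dodging.
Context {R : realType} {G : topGroupType} (g : R -> G).
Variables (Gamma H : groupClosed G) (D0 : set G).
Hypotheses (g_one_param : one_parameter_subgroup g)
  (hG : hausdorff_space G)
  (Gamma_discrete : isolated [set` Gamma] = [set` Gamma])
  (H_horospherical : [set` H] `<=` horospherical g)
  (H_nontrivial : exists2 h, h \in H & h <> 1%g)
  (H_connected : connected [set` H])
  (H_normalized : normalized_by H g)
  (D0_admissible : admissible H D0).
Local Open Scope group_scope.
Local Notation Phi := (conj_flow g).
Let D0H := admissible_sub D0_admissible.
Let cptD0 := admissible_compact D0_admissible.

Lemma conj_flow_uniform_div (V : set G) : nbhs (1 : G) V ->
  \forall t \near +oo%R, forall d d', D0 d -> D0 d' -> V (Phi t (d * d'^-1)).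
Proof.
move=> nV; have [A nA AV] := nbhs_divg 1 nV.
have := conj_flow_uniform g_one_param hG H_horospherical D0_admissible nA.
apply: filterS => t DA d d' Dd Dd'.
by rewrite (conj_flow_div g_one_param); apply: AV; exact: DA.
Qed.

(** Were [p] isolated in [H], the trivial subgroup would be open in [H]. *)
Lemma connected_not_isolated (U : set G) p : open U -> U p -> p \in H ->
  exists q, [/\ U q, q \in H & q <> p].
Proof.
move=> oU Up Hp; apply: contrapT => noq.
have one_H : [set (1 : G)] = [set` H].
  apply: H_connected; first by exists 1.
    exists [set h | U (h * p)].
      apply: (open_comp (f := fun h => h * p)) => // h _; exact: cvg_mulr.
    apply/seteqP; split=> [_ -> | h [/= Hh Uhp]].
      by rewrite /= mul1g; split => //; exact: gpred1.
    apply: contrapT => h1; apply: noq; exists (h * p); split => //.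
      by rewrite gpredM.
    by rewrite -[X in _ <> X]mul1g => /mulIg.
  exists [set 1]; last by rewrite setIC; apply/esym/setIidl => _ ->; exact: gpred1.
  exact: (accessible_closed_set1 (hausdorff_accessible hG)).
have [h Hh h1] := H_nontrivial; apply: h1.
by have : [set (1 : G)] h by rewrite one_H.
Qed.

(** Two distinct points of the interior of [D0], translated by the small sets
    [Phi a D0]: the separating neighbourhood [W] is found before [a], because it
    only depends on the two points. *)
Lemma two_separated_copies : exists (p q : G) (W : set G) (a0 : R),
  [/\ p \in H, q \in H, nbhs (1 : G) W & forall a, (a0 < a)%R ->
    [/\ forall d, D0 d -> D0 (Phi a d * p),
        forall d, D0 d -> D0 (Phi a d * q) &
        forall d d', D0 d -> D0 d' ->
          ~ W ((Phi a d * p) * (Phi a d' * q)^-1)]].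
Proof.
have [_ _ [U [oU [p [Up Hp]] UD]]] := D0_admissible.
have [q [Uq Hq qp]] := connected_not_isolated oU Up Hp.
have sep : \forall vw \near (nbhs ((1, 1) : G * G), nbhs (1 : G)),
    vw.1.1 * p * (vw.1.2 * q)^-1 <> vw.2.
  apply: (near_neq (a := 1 * p * (1 * q)^-1) (b := 1) hG) cvg_snd _.
    apply: cvgMg.
      by apply: cvgMg; [apply: cvg_comp cvg_fst cvg_fst|exact: cvg_cst].
    apply: cvgVg; apply: cvgMg; last exact: cvg_cst.
    exact: cvg_comp cvg_fst cvg_snd.
  by rewrite !mul1g => /divg1_eq /esym.
have [[V1 W] /= [[[V V'] /= [nV nV'] VV1] nW] sepVW] := sep.
have near_U r : U r -> \forall v \near (1 : G), U (v * r).
  move=> Ur; have := @cvg_mulr _ 1 r; rewrite mul1g.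
  by apply; exact: open_nbhs_nbhs.
pose N := [set v | [/\ V v, V' v, U (v * p) & U (v * q)]].
have nN : nbhs (1 : G) N.
  near=> v; split; near: v => //; exact: near_U.
have [a0 [_ aN]] :=
  conj_flow_uniform g_one_param hG H_horospherical D0_admissible nN.
exists p, q, W, a0; split => // a /aN {}aN.
have HPhi d : D0 d -> Phi a d \in H.
  by move=> /D0H Hd; exact: conj_flow_in.
split=> [d Dd | d Dd | d d' Dd Dd' Wdd'].
- by have [_ _ Udp _] := aN d Dd; apply: UD; split => //; rewrite /= gpredM ?HPhi.
- by have [_ _ _ Udq] := aN d Dd; apply: UD; split => //; rewrite /= gpredM ?HPhi.
have [Vd _ _ _] := aN d Dd; have [_ Vd' _ _] := aN d' Dd'.
have V1dd' : V1 (Phi a d, Phi a d') by apply: VV1.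
exact: (sepVW ((Phi a d, Phi a d'), _) (conj V1dd' Wdd')).
Unshelve. all: by end_near. Qed.

(** For [s < 0] the map [Phi s] expands: a translate of [Phi s D0] inside [D0]
    would make the quotients [d * d'^-1] of points of [D0] stay quotients of
    points of [D0] under all iterates of [Phi s], against uniform contraction
    under the iterates of the inverse map. This makes the distance [a + b] between
    two stages of the game positive. *)
Lemma msg_threshold_ge0 (astar : R) : msg_threshold H Phi D0 astar ->
  (0 <= astar)%R.
Proof.
move=> astarP; rewrite leNgt; apply/negP => astar0.
pose s := (- (astar / 2))%R.
have s0 : (0 < s)%R by rewrite oppr_gt0 pmulr_llt0 // invr_gt0.
have [|_ [h _ <-] DD] := astarP (- s)%R.
  by rewrite opprK ltr_pdivlMr // mulr_natr mulr2n gtrDl.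
have [_ _ [U [oU [d0 [Ud0 Hd0]] UD]]] := D0_admissible.
have [d1 [Ud1 Hd1 d10]] := connected_not_isolated oU Ud0 Hd0.
have Dd0 : D0 d0 by exact: UD.
have Dd1 : D0 d1 by exact: UD.
pose k := d1 * d0^-1.
have iter n : exists d d', [/\ D0 d, D0 d' & Phi (- (s *+ n))%R k = d * d'^-1].
  elim: n => [|n [d [d' [Dd Dd' e]]]].
    by exists d1, d0; rewrite mulr0n oppr0 conj_flow0.
  exists (Phi (- s)%R d * h), (Phi (- s)%R d' * h); split.
  - by apply: DD; exists d.
  - by apply: DD; exists d'.
  - by rewrite mulrS opprD conj_flowD // e conj_flow_div // (mulgKA h).
have nk : \forall v \near (1 : G), v <> k.
  apply: (near_neq hG cvg_id (cvg_cst k)) => /esym /divg1_eq; exact: d10.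
have [T [_ TV]] := conj_flow_uniform_div nk.
have [n Tn] : exists n : nat, (T < s *+ n)%R.
  exists (Num.bound `|T / s|%R); rewrite -mulr_natr mulrC -ltr_pdivrMr //.
  by rewrite (le_lt_trans (ler_norm _)) // archi_boundP.
have [d [d' [Dd Dd' e]]] := iter n.
apply: (TV _ Tn d d' Dd Dd'); rewrite -e -conj_flowD //.
by rewrite addrN conj_flow0.
Qed.

(** If [z] lies on a periodic orbit the product below may be a nontrivial
    element of the discrete group [z Gamma z^-1], but it then lies on the
    one-parameter subgroup itself, and so does [Phi s (d * d'^-1)], which is an
    element of [H]. The other elements of [z Gamma z^-1] are bounded away from
    the compact curve [g `[- T, T]]. *)
Lemma late_returns_coincide (z : G) (T : R) : exists c0 : R,
  forall s s' d d', (c0 <= s)%R -> (`|s' - s| <= T)%R -> D0 d -> D0 d' ->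
    z^-1 * (Phi s (d * d'^-1) * g (s' - s)%R) * z \in Gamma -> d = d'.
Proof.
have cptT : compact `[(- T)%R, T]%classic by exact: segment_compact.
pose P (v : G) (r : R) :=
  z^-1 * (v * g r) * z \in Gamma -> exists r', v * g r = g r'.
have near_P : \forall v \near (1 : G), `[(- T)%R, T] `<=` P v.
  apply: ((compact_near_coveringP _).1 cptT) => r _.
  have cvgr : (fun rv : R * G => z^-1 * (rv.2 * g rv.1) * z) @ (r, 1 : G) -->
      z^-1 * (1 * g r) * z.
    apply: cvgMg; last exact: cvg_cst.
    apply: cvgMg; first exact: cvg_cst.
    by apply: cvgMg; [exact: cvg_snd | apply: cvg_one_param => //; exact: cvg_fst].
  have near_eq : \forall rv \near (r, 1 : G),
      z^-1 * (rv.2 * g rv.1) * z \in Gamma ->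
      z^-1 * (rv.2 * g rv.1) * z = z^-1 * (1 * g r) * z.
    exact: cvgr _ (discrete_subgroup_near _ hG Gamma_discrete).
  apply: filterS near_eq => -[r' v] /= eqr Gr; exists r.
  by have := eqr Gr; rewrite mul1g => /mulIg /mulgI.
have [c0 [_ c0P]] := conj_flow_uniform_div near_P.
(* [c0P] holds for times strictly beyond [c0]. *)
exists (c0 + 1)%R => s s' d d' c0s ss' Dd Dd' Gam.
have c0s' : (c0 < s)%R by rewrite (lt_le_trans _ c0s) // ltrDl.
have [|r' e] := c0P s c0s' d d' Dd Dd' (s' - s)%R _ Gam.
  by rewrite /= in_itv /= -ler_norml.
have : Phi s (d * d'^-1) = g (r' - (s' - s))%R.
  by rewrite (g_one_param.2) one_paramN // -e mulgK.
have Hdd' : Phi s (d * d'^-1) \in H.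
  by apply: conj_flow_in => //; rewrite gpredM ?gpredV //; exact: D0H.
move=> eg; apply: divg1_eq; apply: (conj_flow_inj g_one_param (t := s)).
rewrite conj_flow1 // eg; apply: one_param_horospherical H_horospherical _ _ => //.
by rewrite -eg.
Qed.

(** Compactness turns the coincidence of late returns to [z] into an
    approximation: returns to a small neighbourhood [U z] of [z] come from points
    of [D0] that are arbitrarily close. *)
Lemma late_near_returns_close (z : G) (T c0 c : R) (W : set G) :
  (forall s s' d d', (c0 <= s)%R -> (`|s' - s| <= T)%R -> D0 d -> D0 d' ->
     z^-1 * (Phi s (d * d'^-1) * g (s' - s)%R) * z \in Gamma -> d = d') ->
  (c0 <= c)%R -> nbhs (1 : G) W ->
  exists2 U, nbhs (1 : G) U & forall u u' s s' d d', U u -> U u' ->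
    (c <= s <= c + T)%R -> (c <= s' <= c + T)%R -> D0 d -> D0 d' ->
    z^-1 * (u^-1 * (Phi s (d * d'^-1) * g (s' - s)%R) * u') * z \in Gamma ->
    W (d * d'^-1).
Proof.
move=> coincide cc0 nW.
pose I := `[c, (c + T)%R]%classic.
have cptK : compact ((D0 `*` D0) `*` (I `*` I)).
  by apply: compact_setX; apply: compact_setX => //; exact: segment_compact.
pose E (u : G * G) (x : (G * G) * (R * R)) : G :=
  z^-1 * (u.1^-1 * (Phi x.2.1 (x.1.1 * x.1.2^-1) * g (x.2.2 - x.2.1)%R) * u.2) * z.
pose P u x := E u x \in Gamma -> W (x.1.1 * x.1.2^-1).
have near_P : \forall u \near ((1, 1) : G * G), (D0 `*` D0) `*` (I `*` I) `<=` P u.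
  apply: ((compact_near_coveringP _).1 cptK _ (nbhs ((1, 1) : G * G)) P _).
  move=> [[d d'] [s s']] [[/= Dd Dd'] [/= Is Is']].
  pose x0 := ((d, d'), (s, s')) : (G * G) * (R * R).
  have c1 : fst @ (nbhs x0, nbhs ((1, 1) : G * G)) --> x0 by exact: cvg_fst.
  have c2 : snd @ (nbhs x0, nbhs ((1, 1) : G * G)) --> ((1, 1) : G * G).
    exact: cvg_snd.
  have cdd : (fun p : ((G * G) * (R * R)) * (G * G) => p.1.1.1 * p.1.1.2^-1) @
      (nbhs x0, nbhs ((1, 1) : G * G)) --> d * d'^-1.
    apply: cvgMg; last apply: cvgVg.
      exact: (cvg_comp _ _ (cvg_comp _ _ c1 cvg_fst) cvg_fst).
    exact: (cvg_comp _ _ (cvg_comp _ _ c1 cvg_fst) cvg_snd).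
  have cs : (fun p : ((G * G) * (R * R)) * (G * G) => p.1.2.1) @
      (nbhs x0, nbhs ((1, 1) : G * G)) --> s.
    exact: (cvg_comp _ _ (cvg_comp _ _ c1 cvg_snd) cvg_fst).
  have cs' : (fun p : ((G * G) * (R * R)) * (G * G) => p.1.2.2) @
      (nbhs x0, nbhs ((1, 1) : G * G)) --> s'.
    exact: (cvg_comp _ _ (cvg_comp _ _ c1 cvg_snd) cvg_snd).
  have cE : (fun p => E p.2 p.1) @ (nbhs x0, nbhs ((1, 1) : G * G)) -->
      E (1, 1) x0.
    apply: cvgMg; last exact: cvg_cst.
    apply: cvgMg; first exact: cvg_cst.
    apply: cvgMg; last exact: (cvg_comp _ _ c2 cvg_snd).
    apply: cvgMg; first by apply: cvgVg; exact: (cvg_comp _ _ c2 cvg_fst).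
    apply: cvgMg; first by apply: cvg_conj_flow.
    by apply: cvg_one_param => //; exact: cvgB.
  have near_E : \forall p \near (nbhs x0, nbhs ((1, 1) : G * G)),
      E p.2 p.1 \in Gamma -> E p.2 p.1 = E (1, 1) x0.
    exact: cE _ (discrete_subgroup_near _ hG Gamma_discrete).
  have [E0|nE0] := boolP (E (1, 1) x0 \in Gamma); last first.
    apply: filterS near_E => -[x u] /= ex Ex; exfalso.
    by move: nE0; rewrite -(ex Ex) Ex.
  have dd' : d = d'.
    apply: (coincide s s') => //.
    - by move: Is; rewrite /I /= in_itv /= => /andP[+ _]; exact: le_trans.
    - move: Is Is'; rewrite /I /= !in_itv /= => /andP[cs1 cs2] /andP[cs1' cs2'].
      rewrite ler_norml lerBrDr lerBlDr [(- T + s)%R]addrC lerBlDr; apply/andP.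
      split; first by rewrite (le_trans cs2) // lerD2r.
      by rewrite (le_trans cs2') // addrC lerD2l.
    - by move: E0; rewrite /E /= invg1 mul1g mulg1.
  have near_W : \forall p \near (nbhs x0, nbhs ((1, 1) : G * G)),
      W (p.1.1.1 * p.1.1.2^-1).
    by apply: cdd; rewrite dd' mulgV.
  by apply: filterS near_W => -[x u] /= Wx _.
have [[U1 U2] /= [nU1 nU2] UP] := near_P.
exists (U1 `&` U2); first exact: filterI.
move=> u u' s s' d d' [U1u _] [_ U2u'] Is Is' Dd Dd' Gam.
by apply: (UP (u, u') _ ((d, d'), (s, s'))).
Qed.

(** Alice's move. If the copy at [p] is hit, a point of the copy at [q] that is
    hit too would be close to a point of the copy at [p], which the separation
    of the two copies forbids. The lower bound [c1] on the delay [c] is at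
    Alice's disposal: it will make the first window end by time [0]. *)
Lemma dodging_move : exists a0 : R, forall (a T : R) (z : G) (c1 : R),
  (a0 < a)%R -> (0 <= T)%R ->
  exists c U, [/\ (c1 <= c)%R, nbhs (1 : G) U & forall y : G,
    exists e, [/\ e \in H, forall d, D0 d -> D0 (Phi a d * e) &
      forall d s u gam, D0 d -> (c <= s <= c + T)%R -> U u -> gam \in Gamma ->
        g (- s)%R * (Phi a d * e) * y <> u * z * gam]].
Proof.
have [p [q [W [a0 [Hp Hq nW sep]]]]] := two_separated_copies.
exists a0 => a T z c1 /sep [Dp Dq pqW] T0.
have [c0 coincide] := late_returns_coincide z T.
pose c := Num.max c0 c1.
have [|U nU close] := late_near_returns_close (c := c) coincide _ nW.
  by rewrite /c le_max lexx.
exists c, U; split => //; first by rewrite /c le_max lexx orbT.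
move=> y.
pose hit e := exists d s u gam, [/\ D0 d, (c <= s <= c + T)%R, U u, gam \in Gamma &
  g (- s)%R * (Phi a d * e) * y = u * z * gam].
have [hitp|nohitp] := pselect (hit p); last first.
  exists p; split => // d s u gam Dd Is Uu Ggam e.
  by apply: nohitp; exists d, s, u, gam.
exists q; split => // d' s' u' gam' Dd' Is' Uu' Ggam' e'.
have [d [s [u [gam [Dd Is Uu Ggam e]]]]] := hitp.
apply: (pqW d d') => //.
apply: (close u u' s s') => //; [exact: Dp | exact: Dq |].
(* Both returns determine [y]; eliminating it leaves [gam * gam'^-1]. *)
have -> : Phi a d * p * (Phi a d' * q)^-1 =
    (g s * u * z * gam) * (g s' * u' * z * gam')^-1.
  have ey t w v : g (- t)%R * w * y = v -> w = g t * v * y^-1.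
    by move=> <-; rewrite one_paramN // !mulgA mulgV mul1g mulgK.
  by rewrite (ey _ _ _ e) (ey _ _ _ e') mulgKA !mulgA.
suff -> : z^-1 * (u^-1 * (Phi s (g s * u * z * gam * (g s' * u' * z * gam')^-1) *
    g (s' - s)%R) * u') * z = gam * gam'^-1 by rewrite gpredM ?gpredV.
rewrite /conj_flow [(s' - s)%R]addrC (g_one_param.2) !one_paramN // !invgM !mulgA.
by rewrite !(mulgK, mulgVK, mulVg, mul1g).
Qed.

End Dodging.

(** * The game *)

Section Game.
Context {R : realType} {G : topGroupType} (g : R -> G).
Variables (Gamma H : groupClosed G) (D0 : set G).
Hypotheses (g_one_param : one_parameter_subgroup g)
  (hG : hausdorff_space G)
  (Gamma_discrete : isolated [set` Gamma] = [set` Gamma])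
  (H_horospherical : [set` H] `<=` horospherical g)
  (H_nontrivial : exists2 h, h \in H & h <> 1%g)
  (H_connected : connected [set` H])
  (H_normalized : normalized_by H g)
  (D0_admissible : admissible H D0).
Local Open Scope group_scope.
Local Notation Phi := (conj_flow g).

(** The orbit lifted to [G] has to avoid all the sets [U * z * gam] at once: their
    union is the preimage of a neighbourhood of the coset of [z]. *)
Lemma escaping_avoid (x z : G) (U : set G) : nbhs (1 : G) U ->
  (forall t u gam, (0 <= t)%R -> U u -> gam \in Gamma ->
     g t * x <> u * z * gam) ->
  escaping g (\pi_(coset_space Gamma)%qT z) (\pi_(coset_space Gamma)%qT x).
Proof.
move=> nU avoid.
pose N : set (coset_space Gamma) := [set w | exists v, U^° (v * z^-1) /\
  \pi_(coset_space Gamma)%qT v = w].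
have oN : open N.
  suff : open ((\pi_(coset_space Gamma)%qT) @^-1` N) by [].
  rewrite (_ : _ @^-1` N =
      \bigcup_(gam in [set` Gamma]) [set v | U^° (v * (gam * z^-1))]); last first.
    apply/seteqP; split=> [v [v' [Uv' /(@eqmodP _ (coset_equiv Gamma)) e]]|v].
      exists (v^-1 * v') => /=; last by rewrite mulgA mulVKg.
      by move: e; rewrite /= /coset_rel -gpredV invgM invgK.
    move=> [gam /= Ggam Uv]; exists (v * gam); rewrite -mulgA; split => //.
    apply/(@eqmodP _ (coset_equiv Gamma)).
    by rewrite /= /coset_rel invgM mulgVK gpredV.
  apply: bigcup_open => gam _.
  apply: (open_comp (f := fun v => v * (gam * z^-1))).
    by move=> v _; exact: cvg_mulr.
  exact: open_interior.
move=> /(_ N) [|_ [[t /= t0 <-] [v [Uv]]]].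
  apply: open_nbhs_nbhs; split => //; exists z; split => //.
  by rewrite mulgV; exact: nbhs_singleton (nbhs_interior nU).
rewrite translate_pi => /(@eqmodP _ (coset_equiv Gamma)).
rewrite /= /coset_rel => Ggam.
apply: (avoid t (v * z^-1) (v^-1 * (g t * x)) t0) => //.
  exact: interior_subset.
by rewrite mulgVK mulVKg.
Qed.

(** The strategy only looks at Bob's last set and at the number of stages played:
    it picks any legal answer whose points avoid [z] during the window of that
    stage. The delay and the neighbourhood of [z] are chosen once [t1] is known,
    so that the windows of all stages cover all nonnegative times. *)
Lemma escaping_a_winning (astar : R) : msg_threshold H Phi D0 astar ->
  exists2 a0 : R, (0 < a0)%R & forall a, (a0 < a)%R ->
    forall x z : coset_space Gamma,
      a_winning H Phi D0 astar a
        [set h | h \in H /\ escaping g z (translate h x)].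
Proof.
move=> astarP.
have astar0 : (0 <= astar)%R by exact: msg_threshold_ge0 astarP.
have [a1 dodge] := dodging_move g_one_param hG Gamma_discrete H_horospherical
  H_nontrivial H_connected H_normalized D0_admissible.
exists (Num.max 1 (Num.max astar a1))%R; first by rewrite lt_max ltr01.
move=> a; rewrite !gt_max => /and3P[a_gt1 a_astar a_a1] x z; split => // b b_astar.
pose T := (a + b)%R.
have T0 : (0 < T)%R.
  by rewrite addr_gt0 // ?(le_lt_trans astar0) // (lt_trans ltr01).
pose xG := repr x; pose zG := repr z.
have /choice[cU cUP] : forall t1 : R, exists cU : R * set G,
  [/\ (t1 <= cU.1)%R, nbhs (1 : G) cU.2 & forall y : G,
    exists e, [/\ e \in H, forall d, D0 d -> D0 (Phi a d * e) &
      forall d s u gam, D0 d -> (cU.1 <= s <= cU.1 + T)%R -> cU.2 u ->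
        gam \in Gamma ->
        g (- s)%R * (Phi a d * e) * y <> u * zG * gam]].
  move=> t1; have [c [U cU]] := dodge a T zG t1 a_a1 (ltW T0).
  by exists (c, U).
pose time (t1 : R) k := (t1 + T *+ k)%R.
pose good t1 k (B : set G) : set (set G) := [set A |
  [/\ msg_domain H Phi D0 (time t1 k + a)%R A, A `<=` B & forall h t u gam, A h ->
     ((cU t1).1 <= time t1 k - t <= (cU t1).1 + T)%R -> (cU t1).2 u ->
     gam \in Gamma -> g t * (h * xG) <> u * zG * gam]].
have goodP t1 k B : msg_domain H Phi D0 (time t1 k) B -> good t1 k B !=set0.
  move=> [hk Hhk <-]; set t := time t1 k.
  have [_ _ dodge1] := cUP t1.
  have [e [He De avoid]] := dodge1 (g t * (hk * xG)).
  exists [set Phi (t + a)%R d * (Phi t e * hk) | d in D0]; split.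
  - exists (Phi t e * hk) => //; rewrite /= gpredM //.
    exact: conj_flow_in He.
  - move=> _ [d Dd <-]; exists (Phi a d * e); first exact: De.
    by rewrite conj_flowM // (conj_flowD g_one_param t a) -mulgA.
  - move=> _ r u gam [d Dd <-] Ir Uu Ggam.
    have := avoid d _ u gam Dd Ir Uu Ggam; congr (_ <> _).
    rewrite (conj_flowD g_one_param t a) (mulgA (Phi t _)) -conj_flowM //.
    rewrite [Phi t _]/conj_flow opprB.
    by rewrite (g_one_param.2) one_paramN // !mulgA.
pose sigma : strategy := fun t1 s => xget set0 (good t1 (size s).-1 (last set0 s)).
exists sigma => t1 B A.
have goodA k : msg_domain H Phi D0 (time t1 k) (B k) -> good t1 k (B k) (A k).
  move=> /goodP ne; suff -> : A k = xget set0 (good t1 k (B k)) by exact: xgetPex ne.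
  by rewrite /A /answers /sigma size_mkseq mkseqS last_rcons.
split=> [k legal | legal].
  by have [AD AB _] := goodA k (legal k (leqnn k)).1.
have {}goodA k : good t1 k (B k) (A k) by apply: goodA; case: (legal k).
have cptA k : compact (A k).
  have [[h _ <-] _ _] := goodA k.
  apply: continuous_compact; last exact: admissible_compact D0_admissible.
  apply: continuous_subspaceT => d.
  apply: cvgMg; last exact: cvg_cst.
  by apply: cvg_conj_flow; [|exact: cvg_cst | exact: cvg_id].
have [p Ap] : \bigcap_k A k !=set0.
  apply: nested_compact_nonempty => // k.
  - exact: compact_closed.
  - by have [_ AB _] := goodA k.+1; apply: (subset_trans AB); case: (legal k.+1).
  - have [[h _ <-] _ _] := goodA k; have [d Dd] := admissible_nonempty D0_admissible.
    by exists (Phi (time t1 k + a)%R d * h); exists d.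
exists p.
  apply/seteqP; split=> [q Aq | _ ->] //=.
  apply: contrapT => qp.
  have nV : \forall v \near (1 : G), v <> q * p^-1.
    by apply: (near_neq hG cvg_id (cvg_cst _)) => /esym/divg1_eq.
  have [M [_ MV]] :=
    conj_flow_uniform_div g_one_param hG H_horospherical D0_admissible nV.
  have [k Mk] : exists k, (M < time t1 k + a)%R.
    exists (Num.bound `|(M - t1 - a) / T|%R).
    rewrite -ltrBlDr -ltrBlDl addrAC -mulr_natr mulrC -ltr_pdivrMr //.
    by rewrite (le_lt_trans (ler_norm _)) // archi_boundP.
  have [[h _ Ah] _ _] := goodA k.
  have := Ap k I; have := Aq k I; rewrite -Ah => -[d' Dd' eq] [d Dd ep].
  apply: (MV _ Mk d' d Dd' Dd); rewrite conj_flow_div //.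
  by rewrite -eq -ep (mulgKA h).
split=> /=.
  have [[h Hh Ah] _ _] := goodA 0%N.
  have := Ap 0%N I; rewrite -Ah => -[d Dd <-].
  rewrite gpredM //; apply: conj_flow_in => //.
  exact: (admissible_sub D0_admissible).
have [c_ge nU _] := cUP t1.
rewrite -[z]reprK; apply: (escaping_avoid nU) => t u gam t0 Uu Ggam.
(* The windows [time t1 k - c - T <= t <= time t1 k - c] are adjacent and the
   first one ends at [t1 - c <= 0]; [truncn r] counts the later ones that end by
   time [t], and the window after these contains [t]. *)
pose c := (cU t1).1; pose r := ((t - (t1 - c)) / T)%R.
have r0 : (0 <= r)%R.
  apply: divr_ge0; last exact: ltW.
  by rewrite subr_ge0 (le_trans _ t0) // subr_le0.
have /andP[kr rk] := truncn_itv r0.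
have [_ _ avoid] := goodA (Num.truncn r).+1.
apply: avoid Uu Ggam => //; first exact: Ap.
move: kr rk; rewrite /r ler_pdivlMr // ltr_pdivrMr // !mulr_natl /time -/c mulrS.
by set X := (T *+ _)%R => kr rk; apply/andP; split; lra.
Qed.

End Game.

Theorem theorem6p1 (R : realType) (n : nat) (G : lieGroupType R n)
    (Gamma H : groupClosed G) (g : R -> G) (D0 : set G) (astar : R)
    (Gamma_discrete : isolated [set` Gamma] = [set` Gamma])
    (g_one_param : one_parameter_subgroup g)
    (H_horospherical : [set` H] `<=` horospherical g)
    (H_nontrivial : exists2 h, h \in H & h <> 1%g)
    (H_connected : connected [set` H])
    (H_normalized : normalized_by H g)
    (D0_admissible : admissible H D0)
    (astarP : msg_threshold H (conj_flow g) D0 astar) :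
  exists2 a'' : R, 0 < a'' & forall a, a'' < a ->
    forall x z : coset_space Gamma,
      a_winning H (conj_flow g) D0 astar a
        [set h | h \in H /\ escaping g z (translate h x)].
Proof.
exact: (escaping_a_winning g_one_param (@lie_hausdorff R n G)) astarP.
Qed.
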